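(* There is a simple closed analytic curve $\mathcal{R}$ in $\Pi$ such that $\mathcal{R}$ is a conformal solution for $\mathbf{C}$ and $\mathcal{R}\cup -\mathcal{R}$ is the set of unit rectangles in $\Pi$, where $-\mathcal{R}=\{-R: R\in\mathcal{R}\}$.
   Context: Setting. $A,B,C,D$ are lines in $\mathbb{R}^2$ with equations $A: y=m_Ax+b_A$, $B: y=m_Bx+1$, $C: y=m_Cx$, $D: y=m_Dx$ (real $m_A,m_B,m_C,m_D,b_A$), such that the four lines do not all meet in a single point and $C,D$ meet in the origin and only in the origin. $\mathbf{C}$ denotes the configuration consisting of the two pairs $A,C$ and $B,D$. For $w\in\mathbb{R}$: $A(w): y=m_Ax+b_Aw$, $B(w): y=m_Bx+w$, $C(w)=C$, $D(w)=D$, and $\mathbf{C}(w)$ is the resulting configuration. A parallelogram inscribed in $\mathbf{C}(w)$ has vertices $(x_L,y_L)\in L(w)$, $L\in\{A,B,C,D\}$, in this sequence, i.e. $(x_A,y_A)+(x_C,y_C)=(x_B,y_B)+(x_D,y_D)$; degenerate parallelograms (all sides on one line, or a single point) are allowed. $\Pi$ is the set of parallelograms inscribed in $\mathbf{C}(w)$ for some $w\in\mathbb{R}$ ($w$ is then the scale), a three-dimensional real vector space under coordinatewise operations on vertices. Those of scale $1$ are inscribed in $\mathbf{C}$; those of scale $0$ are at infinity for $\mathbf{C}$. For $P\in\Pi$, $P_{AC}=(x_A-x_C,y_A-y_C)$ and $P_{BD}=(x_B-x_D,y_B-y_D)$ are the diagonal vectors. The inner product on $\Pi$ is $\langle P,Q\rangle=P_{AC}\cdot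 Q_{AC}+P_{BD}\cdot Q_{BD}$, with norm $\|P\|=\langle P,P\rangle^{1/2}$. A rectangle in $\Pi$ is a parallelogram (possibly degenerate) whose diagonals have equal length; a unit rectangle is a rectangle of norm $1$. A rectangle $R$ is scaled from a rectangle $R'$ (and $R'$ scales to $R$) if $R$ is a scalar multiple of $R'$ in $\Pi$. A conformal solution for $\mathbf{C}$ is a set $\mathcal{R}$ of rectangles in $\Pi$ such that each rectangle $R$ inscribed in $\mathbf{C}$, and each rectangle $R$ at infinity for $\mathbf{C}$, is scaled from a rectangle $R'$ in $\mathcal{R}$, and for all but at most one such rectangle $R$ there is a unique rectangle $R'$ in $\mathcal{R}$ that scales to $R$. Here the rectangles $R$ inscribed in $\mathbf{C}$ or at infinity are understood not to be the zero element of $\Pi$ (the parallelogram all of whose vertices are the origin).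
   Formalization: The curve may have corners (arcs analytic on each side) at points R of the curve with -R also on it, which occur only when the unit rectangles form two crossing ellipses; and the ''at most one'' exceptional rectangle is counted up to scalar multiples. *)

(* Defs.v *)
From Stdlib Require Export Reals.
From Coquelicot Require Export Coquelicot.
Open Scope R_scope.

(** * Lines and configurations *)

Definition point : Type := (R * R)%type.

Definition line (m b : R) (p : point) : Prop := snd p = m * fst p + b.

Record configuration : Type := Config {
  slopeA : R; slopeB : R; slopeC : R; slopeD : R; interceptA : R }.

Definition lineA (c : configuration) (w : R) : point -> Prop :=
  line (slopeA c) (interceptA c * w).
Definition lineB (c : configuration) (w : R) : point -> Prop :=
  line (slopeB c) w.
Definition lineC (c : configuration) (w : R) : point -> Prop :=
  line (slopeC c) 0.
Definition lineD (c : configuration) (w : R) : point -> Prop :=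
  line (slopeD c) 0.

(** * The space of inscribed parallelograms *)

(** A quadruple of vertices, on A, B, C, D in this order.  Coquelicot's product
    structures make it a normed module over R, so that [plus], [opp], [scal],
    [zero] and [is_pseries] act coordinatewise. *)
Definition quad : Type := (point * point * point * point)%type.

Definition vA (P : quad) : point := fst (fst (fst P)).
Definition vB (P : quad) : point := snd (fst (fst P)).
Definition vC (P : quad) : point := snd (fst P).
Definition vD (P : quad) : point := snd P.

Definition inscribed (c : configuration) (w : R) (P : quad) : Prop :=
  lineA c w (vA P) /\ lineB c w (vB P) /\ lineC c w (vC P) /\ lineD c w (vD P) /\
  plus (vA P) (vC P) = plus (vB P) (vD P).

Definition Pi_space (c : configuration) (P : quad) : Prop :=
  exists w : R, inscribed c w P.

Definition inscribed_in (c : configuration) (P : quad) : Prop := inscribed c 1 P.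
Definition at_infinity (c : configuration) (P : quad) : Prop := inscribed c 0 P.

Definition dot (u v : point) : R := fst u * fst v + snd u * snd v.

Definition diagAC (P : quad) : point := minus (vA P) (vC P).
Definition diagBD (P : quad) : point := minus (vB P) (vD P).

Definition inner (P Q : quad) : R :=
  dot (diagAC P) (diagAC Q) + dot (diagBD P) (diagBD Q).
Definition Pi_norm (P : quad) : R := sqrt (inner P P).

Definition length (u : point) : R := sqrt (dot u u).

Definition rectangle (c : configuration) (P : quad) : Prop :=
  Pi_space c P /\ length (diagAC P) = length (diagBD P).

Definition unit_rectangle (c : configuration) (P : quad) : Prop :=
  rectangle c P /\ Pi_norm P = 1.

(** * Conformal solutions *)

Definition scaled_from (P P' : quad) : Prop := exists a : R, P = scal a P'.

Definition target_rectangle (c : configuration) (P : quad) : Prop :=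
  rectangle c P /\ P <> zero /\ (inscribed_in c P \/ at_infinity c P).

(** The exceptional rectangle is counted up to scaling.  Two inscribed rectangles
    that are multiples of each other are equal, so this only matters at infinity,
    where the nonzero multiples of a rectangle are again rectangles at infinity
    and are scaled from the same members of [S]. *)
Definition conformal_solution (c : configuration) (S : quad -> Prop) : Prop :=
  (forall P, S P -> rectangle c P) /\
  (forall P, target_rectangle c P -> exists P', S P' /\ scaled_from P P') /\
  (forall P Q, target_rectangle c P -> target_rectangle c Q ->
     ~ (exists! P', S P' /\ scaled_from P P') ->
     ~ (exists! Q', S Q' /\ scaled_from Q Q') ->
     scaled_from P Q).

(** * Analytic curves *)

(** [a 1] is the derivative of [f] at [t]; it is required to be nonzero. *)
Definition regular_analytic_at (f : R -> quad) (t : R) : Prop :=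
  exists (a : nat -> quad) (r : R), 0 < r /\
    (forall s, Rabs (s - t) < r -> is_pseries a (s - t) (f s)) /\
    a 1%nat <> zero.

(** At a corner the two arcs still extend analytically across the corner. *)
Definition corner_at (f : R -> quad) (t : R) : Prop :=
  exists (g h : R -> quad) (r : R), 0 < r /\
    regular_analytic_at g t /\ regular_analytic_at h t /\
    (forall s, t - r < s <= t -> f s = g s) /\
    (forall s, t <= s < t + r -> f s = h s).

(** Corners are tolerated only at points of [E]; for empty [E] this is the
    usual notion of a simple closed (regular) analytic curve. *)
Definition simple_closed_analytic_curve (E S : quad -> Prop) : Prop :=
  exists (f : R -> quad) (T : R), 0 < T /\
    (forall s t, f s = f t <-> exists k : Z, s = t + IZR k * T) /\
    (forall P, S P <-> exists t, f t = P) /\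
    (forall t, regular_analytic_at f t \/ (E (f t) /\ corner_at f t)).

Definition neg_set (S : quad -> Prop) (P : quad) : Prop :=
  exists Q, S Q /\ P = opp Q.

(** If the quadratic form |P_AC|^2 - |P_BD|^2 is degenerate on Pi, the unit
    rectangles form two ellipses crossing at a pair K, -K (for example for the
    lines y = x + 2, y = 1, y = 0, y = x).  A simple closed curve that covers them
    up to sign consists of a half of each ellipse, with corners at K and -K.
    Otherwise the unit rectangles form two disjoint ovals exchanged by negation,
    and no point of the curve is a double point. *)
Definition double_points (S : quad -> Prop) (P : quad) : Prop :=
  S P /\ neg_set S P.

(* Main.v *)
Require Import Defs.
From Stdlib Require Import Reals ZArith Lra Lia Psatz Classical.

(** Sending a parallelogram to its pair of diagonal vectors identifies [Pi] with a
    hyperplane of [R^4], on which rectangles are the pairs [(u, v)] with [|u| = |v|].  Up to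
    exchanging the two diagonals and rotating each of them, the hyperplane is
    [u_1 = - k v_1] with [0 <= k <= 1], so that the unit rectangles are the points
    [v = (cos t, sin t)], [u = (- k cos t, +- sqrt (1 - k^2 cos^2 t))] (up to the factor
    [1 / sqrt 2]).  The sign [+] gives the curve.  It is analytic where the radicand is
    positive; the radicand vanishes only for [k = 1] and [sin t = 0], where the square root
    is [|sin t|] and the curve has a corner at a double point. *)

(** * Power series expansions *)

Definition expands (f : R -> R) (t : R) (a : nat -> R) : Prop :=
  exists r, 0 < r /\ forall s, Rabs (s - t) < r -> is_pseries a (s - t) (f s).

Lemma CV_radius_ge (a : nat -> R) (r M : R) :
  (forall n, Rabs (a n * r ^ n) <= M) -> Rbar_le r (CV_radius a).
Proof.
  intros H. destruct (CV_radius_bounded a) as [Hub _]. apply Hub. exists M. exact H.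
Qed.

Lemma series_terms_bounded (u : nat -> R) :
  ex_series u -> exists M, 0 < M /\ forall n, Rabs (u n) <= M.
Proof.
  intros H%ex_series_lim_0.
  destruct (filterlim_bounded u) as [M HM].
  { exists 0. exact H. }
  exists (M + 1). assert (H0 := HM 0%nat). change (Rabs (u 0%nat) <= M) in H0.
  assert (0 <= Rabs (u 0%nat)) by apply Rabs_pos.
  split; [lra|]. intros n. assert (Hn := HM n). change (Rabs (u n) <= M) in Hn. lra.
Qed.

(** Inside the interval, at [t + r / 2], the terms of the convergent series are bounded. This gives
    a positive radius of convergence and a geometric bound on the coefficients. *)
Lemma expands_bounded f t a :
  expands f t a -> exists r M, 0 < r /\ 0 < M /\ forall n, Rabs (a n * r ^ n) <= M.
Proof.
  intros (r & Hr & H). exists (r / 2).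
  assert (Hs : is_pseries a (r / 2) (f (t + r / 2))).
  { replace (r / 2) with (t + r / 2 - t) at 1 by ring. apply H.
    rewrite Rabs_pos_eq; lra. }
  rewrite is_pseries_R in Hs.
  destruct (series_terms_bounded (fun n => a n * (r / 2) ^ n)) as (M & HM & HB).
  { exists (f (t + r / 2)). exact Hs. }
  exists M. repeat split; try lra. exact HB.
Qed.

Lemma is_pseries_const (p x : R) :
  is_pseries (fun n : nat => match n with O => p | _ => 0 end) x p.
Proof.
  rewrite is_pseries_R. apply is_series_Reals. intros e He. exists 0%nat. intros n _.
  replace (sum_f_R0 _ n) with p.
  - unfold Rdist. rewrite Rminus_diag, Rabs_R0. exact He.
  - induction n; simpl in *; [ring|]. rewrite <- IHn. ring.
Qed.

Lemma expands_affine p q f t a :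
  expands f t a ->
  expands (fun s => p + q * f s) t (fun n => (match n with O => p | _ => 0 end) + q * a n).
Proof.
  intros (r & Hr & H). exists r. split; [exact Hr|]. intros s Hs.
  apply (is_pseries_plus (V := R_NormedModule) (fun n => match n with O => p | _ => 0 end)
           (fun n => q * a n)).
  - apply is_pseries_const.
  - apply (is_pseries_scal (V := R_NormedModule) q). { apply Rmult_comm. }
    now apply H.
Qed.

(** The Cauchy product converges inside both radii of convergence, which the bounded terms keep away
    from 0; hence the minimum of four radii. *)
Lemma expands_mult f g t a b :
  expands f t a -> expands g t b -> expands (fun s => f s * g s) t (PS_mult a b).
Proof.
  intros Ha Hb.
  destruct (expands_bounded _ _ _ Ha) as (ra & Ma & Hra & _ & Ba%CV_radius_ge).
  destruct (expands_bounded _ _ _ Hb) as (rb & Mb & Hrb & _ & Bb%CV_radius_ge).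
  destruct Ha as (r & Hr & Ha), Hb as (r' & Hr' & Hb).
  exists (Rmin (Rmin ra rb) (Rmin r r')). split.
  { repeat apply Rmin_glb_lt; assumption. }
  intros s Hs.
  assert (H1 := Rmin_l (Rmin ra rb) (Rmin r r')). assert (H2 := Rmin_r (Rmin ra rb) (Rmin r r')).
  assert (H3 := Rmin_l ra rb). assert (H4 := Rmin_r ra rb).
  assert (H5 := Rmin_l r r'). assert (H6 := Rmin_r r r').
  apply is_pseries_mult; [apply Ha | apply Hb | |]; try lra.
  - eapply Rbar_lt_le_trans; [|exact Ba]. simpl. lra.
  - eapply Rbar_lt_le_trans; [|exact Bb]. simpl. lra.
Qed.

(** Taylor coefficients at 0 of [p * cos x + q * sin x]. Here [cos_n] and [sin_n] are the
    coefficients of [cos x] and [sin x / x] as series in [x ^ 2], so they are interleaved by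
    parity. *)
Definition trig_coef (p q : R) (n : nat) : R :=
  if Nat.even n then p * cos_n (Nat.div2 n) else q * sin_n (Nat.div2 n).

Lemma trig_pseries (p q x : R) :
  is_pseries (trig_coef p q) x (p * cos x + q * sin x).
Proof.
  replace (p * cos x + q * sin x)
    with (p * cos x + x * (q * (let (l, _) := exist_sin (x ^ 2) in l))).
  2:{ unfold sin. rewrite Rsqr_pow2. destruct (exist_sin (x ^ 2)) as [l _]. ring. }
  apply is_pseries_odd_even.
  - apply is_pseries_ext with (fun n => p * cos_n n).
    { intros n. unfold trig_coef. replace (Nat.even (2 * n)) with true.
      - now rewrite Nat.div2_double.
      - symmetry. apply Nat.even_spec. exists n. lia. }
    apply (is_pseries_scal (V := R_NormedModule) p). { apply Rmult_comm. }
    rewrite is_pseries_R. apply is_series_Reals.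
    unfold cos. rewrite Rsqr_pow2. destruct (exist_cos (x ^ 2)) as [l Hl]. exact Hl.
  - apply is_pseries_ext with (fun n => q * sin_n n).
    { intros n. unfold trig_coef. replace (Nat.even (2 * n + 1)) with false.
      - now rewrite Nat.add_1_r, Nat.div2_succ_double.
      - rewrite Nat.add_1_r, Nat.even_succ. symmetry. rewrite <- Nat.negb_even.
        replace (Nat.even (2 * n)) with true; [reflexivity|].
        symmetry. apply Nat.even_spec. exists n. lia. }
    apply (is_pseries_scal (V := R_NormedModule) q). { apply Rmult_comm. }
    rewrite is_pseries_R. apply is_series_Reals.
    destruct (exist_sin (x ^ 2)) as [l Hl]. exact Hl.
Qed.

Lemma expands_cos t : expands cos t (trig_coef (cos t) (- sin t)).
Proof.
  exists 1. split; [lra|]. intros s _.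
  replace (cos s) with (cos t * cos (s - t) + - sin t * sin (s - t)).
  - apply trig_pseries.
  - replace s with (t + (s - t)) at 3 by ring. rewrite cos_plus. ring.
Qed.

Lemma expands_sin t : expands sin t (trig_coef (sin t) (cos t)).
Proof.
  exists 1. split; [lra|]. intros s _.
  replace (sin s) with (sin t * cos (s - t) + cos t * sin (s - t)).
  - apply trig_pseries.
  - replace s with (t + (s - t)) at 3 by ring. rewrite sin_plus. ring.
Qed.

Lemma trig_coef_1 p q : trig_coef p q 1 = q.
Proof. unfold trig_coef, sin_n; simpl; field. Qed.

(** * Square roots of power series *)

(** Coefficients of [sqrt h - b], for [h] with coefficients [a] and [b = sqrt (a 0)]:
    they solve [2 b c + c * c = a - a 0].  Row [N] agrees with the solution up to
    index [N] and is zero beyond. *)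
Fixpoint sqrt_rows (a : nat -> R) (b : R) (N : nat) : nat -> R :=
  match N with
  | O => fun _ => 0
  | S N' => fun n =>
      if (n =? N)%nat
      then (a N - PS_mult (sqrt_rows a b N') (sqrt_rows a b N') N) / (2 * b)
      else sqrt_rows a b N' n
  end.

Definition sqrt_coef (a : nat -> R) (b : R) (n : nat) : R := sqrt_rows a b n n.

Lemma sqrt_rows_above a b N n : (N < n)%nat -> sqrt_rows a b N n = 0.
Proof.
  induction N as [|N IH]; intros H; [reflexivity|]. simpl.
  destruct (Nat.eqb_spec n (S N)); [lia|]. apply IH. lia.
Qed.

Lemma sqrt_rows_below a b N n : (n <= N)%nat -> sqrt_rows a b N n = sqrt_coef a b n.
Proof.
  induction N as [|N IH]; intros H.
  - now replace n with 0%nat by lia.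
  - destruct (Nat.eq_dec n (S N)) as [->|Hn]; [reflexivity|].
    rewrite <- IH by lia. simpl. destruct (Nat.eqb_spec n (S N)); [lia|reflexivity].
Qed.

(** Row [N] lacks the coefficient of index [S N], but in the Cauchy square of index [S N] that
    coefficient is multiplied by coefficient 0, which vanishes. Hence the recursion closes on
    [sqrt_coef] itself. *)
Lemma sqrt_rows_square a b N n : (n <= S N)%nat ->
  PS_mult (sqrt_rows a b N) (sqrt_rows a b N) n = PS_mult (sqrt_coef a b) (sqrt_coef a b) n.
Proof.
  intros H. apply sum_eq. intros i Hi.
  destruct (Nat.eq_dec i (S N)) as [E|E1].
  { replace (n - i)%nat with 0%nat by lia.
    rewrite (sqrt_rows_below _ _ _ 0) by lia. change (sqrt_coef a b 0) with 0. ring. }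
  destruct (Nat.eq_dec (n - i) (S N)) as [E|E2].
  { replace i with 0%nat by lia.
    rewrite (sqrt_rows_below _ _ _ 0) by lia. change (sqrt_coef a b 0) with 0. ring. }
  now rewrite !sqrt_rows_below by lia.
Qed.

Lemma sqrt_coef_S a b n :
  sqrt_coef a b (S n)
  = (a (S n) - PS_mult (sqrt_coef a b) (sqrt_coef a b) (S n)) / (2 * b).
Proof.
  rewrite <- (sqrt_rows_square a b n (S n)) by lia.
  unfold sqrt_coef at 1. simpl sqrt_rows. now rewrite Nat.eqb_refl.
Qed.

(** Expanding the square of the partial sum gives all Cauchy products up to index [N] and further
    nonnegative terms. *)
Lemma sum_PS_mult_le (u : nat -> R) (N : nat) :
  (forall n, 0 <= u n) ->
  sum_f_R0 (PS_mult u u) N <= (sum_f_R0 u N) ^ 2.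
Proof.
  intros H. destruct N as [|N]. { cbv [PS_mult sum_f_R0 Nat.sub]. lra. }
  rewrite <- Rsqr_pow2. unfold Rsqr. rewrite (cauchy_finite u u (S N)) by lia.
  change (sum_f_R0 (PS_mult u u)) with
    (sum_f_R0 (fun k => sum_f_R0 (fun p => u p * u (k - p)%nat) k)).
  apply Rplus_le_reg_l with (- sum_f_R0 (fun k => sum_f_R0 (fun p => u p * u (k - p)%nat) k) (S N)).
  ring_simplify. apply cond_pos_sum. intros k. apply cond_pos_sum. intros l.
  now apply Rmult_le_pos.
Qed.

Lemma Rabs_PS_mult_le (u : nat -> R) (r : R) (n : nat) : 0 <= r ->
  Rabs (PS_mult u u n) * r ^ n
  <= PS_mult (fun i => Rabs (u i) * r ^ i) (fun i => Rabs (u i) * r ^ i) n.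
Proof.
  intros Hr. unfold PS_mult.
  eapply Rle_trans.
  { apply Rmult_le_compat_r; [now apply pow_le|]. apply Rsum_abs. }
  rewrite Rmult_comm, scal_sum. right. apply sum_eq. intros i Hi.
  rewrite Rabs_mult. replace (r ^ n) with (r ^ i * r ^ (n - i)); [ring|].
  rewrite <- pow_add. f_equal. lia.
Qed.

(** A majorant argument: the recursion gives [D (S N) <= (b ^ 2 + D N ^ 2) / (2 * b)] for the
    weighted partial sums, so the bound [D N <= b] reproduces itself. *)
Lemma sqrt_coef_sum_le a b r N : 0 < b -> 0 <= r ->
  (forall K, sum_f_R0 (fun n => Rabs (a (S n)) * r ^ S n) K <= b ^ 2) ->
  sum_f_R0 (fun n => Rabs (sqrt_coef a b n) * r ^ n) N <= b.
Proof.
  intros Hb Hr Ha.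
  set (D := fun N => sum_f_R0 (fun n => Rabs (sqrt_coef a b n) * r ^ n) N).
  fold (D N). induction N as [|N IH].
  { unfold D. simpl. change (sqrt_coef a b 0) with 0. rewrite Rabs_R0. lra. }
  (* Row [N] is zero at [S N], so summing [w] up to [S N] still gives [D N]; this lets the Cauchy
     square of index [S N] be bounded by [D N ^ 2]. *)
  set (w := fun n => Rabs (sqrt_rows a b N n) * r ^ n).
  assert (Hw : forall n, 0 <= w n).
  { intros n. apply Rmult_le_pos; [apply Rabs_pos | now apply pow_le]. }
  assert (Dw : sum_f_R0 w (S N) = D N).
  { simpl. unfold w at 2. rewrite sqrt_rows_above by lia. rewrite Rabs_R0, Rmult_0_l, Rplus_0_r.
    apply sum_eq. intros i Hi. unfold w. now rewrite sqrt_rows_below by lia. }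
  assert (HD : D (S N) <= / (2 * b) *
     (sum_f_R0 (fun n => Rabs (a (S n)) * r ^ S n) N + sum_f_R0 (PS_mult w w) (S N))).
  { unfold D. rewrite decomp_sum by lia. rewrite (decomp_sum (PS_mult w w)) by lia. simpl pred.
    change (sqrt_coef a b 0) with 0 at 1.
    replace (PS_mult w w 0) with 0.
    2:{ unfold PS_mult. simpl. unfold w. rewrite sqrt_rows_below by lia.
        change (sqrt_coef a b 0) with 0. rewrite Rabs_R0. ring. }
    rewrite Rabs_R0, Rmult_0_l, !Rplus_0_l, <- sum_plus, scal_sum.
    apply sum_Rle. intros n Hn. rewrite sqrt_coef_S, <- (sqrt_rows_square a b N) by lia.
    unfold Rdiv. rewrite Rabs_mult, (Rabs_pos_eq (/ (2 * b))).
    2:{ left. apply Rinv_0_lt_compat. lra. }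
    rewrite Rmult_assoc, (Rmult_comm (/ (2 * b))), <- Rmult_assoc.
    apply Rmult_le_compat_r. { left. apply Rinv_0_lt_compat. lra. }
    eapply Rle_trans.
    2:{ apply Rplus_le_compat_l. apply Rabs_PS_mult_le. exact Hr. }
    rewrite <- Rmult_plus_distr_r. apply Rmult_le_compat_r; [now apply pow_le|].
    eapply Rle_trans; [apply Rabs_triang|]. rewrite Rabs_Ropp. lra. }
  assert (HP := sum_PS_mult_le w (S N) Hw). rewrite Dw in HP.
  assert (D0 : 0 <= D N) by (rewrite <- Dw; apply cond_pos_sum; exact Hw).
  assert (HaN := Ha N).
  eapply Rle_trans; [exact HD|].
  apply Rmult_le_reg_l with (2 * b); [lra|].
  rewrite <- Rmult_assoc, Rinv_r by lra. nra.
Qed.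

(** The formal solution converges by the majorant bound; its sum plus [b] squares to [h] and is
    nonnegative near [t], hence is the square root. *)
Lemma expands_sqrt h t a : expands h t a -> 0 < h t ->
  exists b, expands (fun s => sqrt (h s)) t b.
Proof.
  intros Hh ht.
  destruct (expands_bounded _ _ _ Hh) as (rho & M & Hrho & HM & HB).
  destruct Hh as (r0 & Hr0 & Hh).
  assert (a0 : a 0%nat = h t).
  { assert (H : is_pseries a (t - t) (h t)).
    { apply Hh. rewrite Rminus_diag, Rabs_R0. exact Hr0. }
    rewrite Rminus_diag in H. apply is_pseries_unique in H.
    rewrite <- H. symmetry. apply PSeries_0. }
  set (b := sqrt (h t)).
  assert (Hb : 0 < b) by now apply sqrt_lt_R0.
  assert (Hb2 : b ^ 2 = h t). { unfold b. rewrite pow2_sqrt; lra. }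
  (* Chosen so that the geometric majorant [M * (l + l ^ 2 + ...)] of the nonconstant terms of [h]
     at radius [rho * l] sums to exactly [h t = b ^ 2]. *)
  set (l := h t / (M + h t)).
  assert (Hl : 0 < l) by (apply Rdiv_lt_0_compat; lra).
  assert (Hl1 : M * l = h t * (1 - l)) by (unfold l; field; lra).
  set (r := rho * l).
  assert (Hr : 0 < r) by now apply Rmult_lt_0_compat.
  set (c := sqrt_coef a b).
  assert (Hc : forall N, sum_f_R0 (fun n => Rabs (c n) * r ^ n) N <= b).
  { intros N. apply sqrt_coef_sum_le; try lra. intros K. rewrite Hb2.
    apply Rle_trans with (h t * (1 - l ^ S K)).
    2:{ assert (0 < l ^ S K) by now apply pow_lt. nra. }
    (* The geometric bound is written as a difference, so that the sum telescopes. *)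
    assert (Hterm : forall n, Rabs (a (S n)) * r ^ S n <= h t * (l ^ n - l ^ S n)).
    { intros n. unfold r. rewrite Rpow_mult_distr, <- Rmult_assoc.
      replace (h t * (l ^ n - l ^ S n)) with (M * l ^ S n).
      2:{ simpl. rewrite <- Rmult_assoc, Hl1. ring. }
      apply Rmult_le_compat_r. { left. now apply pow_lt. }
      assert (H := HB (S n)). rewrite Rabs_mult, (Rabs_pos_eq (rho ^ S n)) in H; [exact H|].
      left. now apply pow_lt. }
    induction K as [|K IH].
    - simpl. assert (H := Hterm 0%nat). simpl in H. lra.
    - rewrite tech5. assert (H := Hterm (S K)). lra. }
  assert (Hpos : forall n, 0 <= Rabs (c n) * r ^ n).
  { intros n. apply Rmult_le_pos; [apply Rabs_pos | left; now apply pow_lt]. }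
  assert (Hradc : Rbar_le r (CV_radius c)).
  { apply CV_radius_ge with b. intros n.
    rewrite Rabs_mult, (Rabs_pos_eq (r ^ n)) by (left; now apply pow_lt).
    apply Rle_trans with (2 := Hc n). destruct n as [|n]; [right; reflexivity|].
    rewrite tech5. assert (0 <= sum_f_R0 (fun n => Rabs (c n) * r ^ n) n)
      by (apply cond_pos_sum; exact Hpos). lra. }
  assert (Hexp : expands (fun s => PSeries c (s - t)) t c).
  { exists r. split; [exact Hr|]. intros s Hs. apply PSeries_correct, CV_radius_inside.
    eapply Rbar_lt_le_trans; [|exact Hradc]. exact Hs. }
  exists (fun n => (match n with O => b | _ => 0 end) + 1 * c n).
  assert (Haff := expands_affine b 1 _ _ _ Hexp).
  assert (Hsq := expands_mult _ _ _ _ _ Hexp Hexp).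
  assert (Hcont : continuity_pt (PSeries c) 0).
  { apply PSeries_continuity. rewrite Rabs_R0. eapply Rbar_lt_le_trans; [|exact Hradc]. exact Hr. }
  destruct (Hcont b Hb) as (d & Hd & Hcd).
  destruct Haff as (r1 & Hr1 & Haff). destruct Hsq as (r2 & Hr2 & Hsq).
  destruct Hexp as (r3 & Hr3 & Hexp).
  exists (Rmin (Rmin d r0) (Rmin r1 (Rmin r2 r3))). split.
  { repeat apply Rmin_glb_lt; assumption. }
  intros s Hs.
  assert (H1 := Rmin_l (Rmin d r0) (Rmin r1 (Rmin r2 r3))).
  assert (H2 := Rmin_r (Rmin d r0) (Rmin r1 (Rmin r2 r3))).
  assert (H3 := Rmin_l d r0). assert (H4 := Rmin_r d r0).
  assert (H5 := Rmin_l r1 (Rmin r2 r3)). assert (H6 := Rmin_r r1 (Rmin r2 r3)).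
  assert (H7 := Rmin_l r2 r3). assert (H8 := Rmin_r r2 r3).
  assert (Hs1 : Rabs (s - t) < r1) by lra. specialize (Haff s Hs1).
  (* Coefficientwise, [b ^ 2 + 2 * b * c + c * c = a] is the recursion for positive indices; at
     index 0 it is [a 0 = h t], since [c 0 = 0]. *)
  assert (Hsquare : (b + PSeries c (s - t)) * (b + PSeries c (s - t)) = h s).
  { assert (E1 := is_pseries_unique _ _ _ (Hh s ltac:(lra))).
    assert (S1 := Hexp s ltac:(lra)). assert (S2 := Hsq s ltac:(lra)).
    rewrite <- E1. symmetry. apply is_pseries_unique.
    assert (S3 := is_pseries_plus (V := R_NormedModule) _ _ _ _ _
      (is_pseries_scal (V := R_NormedModule) (2 * b) _ _ _ (Rmult_comm _ _) S1) S2).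
    assert (S4 := is_pseries_plus (V := R_NormedModule) _ _ _ _ _
      (is_pseries_const (h t) (s - t)) S3).
    replace ((b + PSeries c (s - t)) * (b + PSeries c (s - t))) with
      (plus (h t) (plus (scal (2 * b) (PSeries c (s - t)))
        (PSeries c (s - t) * PSeries c (s - t)))).
    2:{ rewrite <- Hb2. unfold plus, scal; simpl; unfold mult; simpl. ring. }
    apply is_pseries_ext with (2 := S4). intros n.
    unfold PS_plus, PS_scal, plus, scal; simpl; unfold mult; simpl.
    destruct n as [|n].
    - unfold PS_mult. simpl. change (c 0%nat) with 0. rewrite a0. ring.
    - unfold c. rewrite (sqrt_coef_S a b n). field. lra. }
  (* The sum of [c] vanishes at [t] and is continuous there, so it stays below [b] in absolute
     value; this selects the sign of the root. *)
  assert (Hge : 0 <= b + PSeries c (s - t)).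
  { assert (C0 : PSeries c 0 = 0) by apply PSeries_0.
    destruct (Req_dec (s - t) 0) as [->|Hne]; [lra|].
    assert (H : Rdist (PSeries c (s - t)) (PSeries c 0) < b).
    { apply Hcd. split.
      - split; [exact I|]. auto.
      - simpl. unfold Rdist. rewrite Rminus_0_r. lra. }
    unfold Rdist in H. rewrite C0, Rminus_0_r in H. apply Rabs_def2 in H. lra. }
  replace (sqrt (h s)) with (b + 1 * PSeries c (s - t)); [exact Haff|].
  rewrite <- Hsquare, Rmult_1_l. symmetry. now apply sqrt_square.
Qed.

(** * Diagonals and rectangles *)

Definition comb (P1 P2 P3 : quad) (x y z : R) : quad :=
  plus (plus (scal x P1) (scal y P2)) (scal z P3).

Ltac split_pairs := repeat match goal with |- (_, _) = (_, _) => apply f_equal2 end.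
Ltac quad_ring := cbv -[Rplus Rmult Ropp IZR]; split_pairs; ring.

Lemma comb_scal P1 P2 P3 a x y z :
  scal a (comb P1 P2 P3 x y z) = comb P1 P2 P3 (a * x) (a * y) (a * z).
Proof.
  destruct P1 as [[[[] []] []] []], P2 as [[[[] []] []] []], P3 as [[[[] []] []] []].
  quad_ring.
Qed.

Lemma comb_opp P1 P2 P3 x y z :
  opp (comb P1 P2 P3 x y z) = comb P1 P2 P3 (- x) (- y) (- z).
Proof.
  destruct P1 as [[[[] []] []] []], P2 as [[[[] []] []] []], P3 as [[[[] []] []] []].
  quad_ring.
Qed.

Lemma comb_minus P1 P2 P3 x y z x' y' z' :
  minus (comb P1 P2 P3 x y z) (comb P1 P2 P3 x' y' z') = comb P1 P2 P3 (x - x') (y - y') (z - z').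
Proof.
  destruct P1 as [[[[] []] []] []], P2 as [[[[] []] []] []], P3 as [[[[] []] []] []].
  unfold minus. quad_ring.
Qed.

Lemma comb_0 P1 P2 P3 : comb P1 P2 P3 0 0 0 = zero.
Proof.
  destruct P1 as [[[[] []] []] []], P2 as [[[[] []] []] []], P3 as [[[[] []] []] []].
  quad_ring.
Qed.

Lemma comb_fst P1 P2 P3 x : comb P1 P2 P3 x 0 0 = scal x P1.
Proof.
  destruct P1 as [[[[] []] []] []], P2 as [[[[] []] []] []], P3 as [[[[] []] []] []].
  quad_ring.
Qed.

(** [(mx, my)] is twice the center. It is the solution of the two linear equations placing the
    vertices [C] and [D] on their lines through the origin, which are independent when the slopes
    differ. *)
Definition of_diagonals (c : configuration) (u v : point) : quad :=
  let mx := (slopeC c * fst u - snd u - slopeD c * fst v + snd v) / (slopeC c - slopeD c) in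
  let my := slopeC c * (mx - fst u) + snd u in
  (((mx + fst u) / 2, (my + snd u) / 2), ((mx + fst v) / 2, (my + snd v) / 2),
   ((mx - fst u) / 2, (my - snd u) / 2), ((mx - fst v) / 2, (my - snd v) / 2)).

(** Normal vector of the space of diagonal pairs [(P_AC, P_BD)] in [R^4], obtained by
    eliminating the center of the parallelogram and the scale. *)
Definition normalAC (c : configuration) : point :=
  let (mA, mB, mC, mD, b) := c in
  (mC * mD * (1 - b) + b * mB * mC - 2 * mA * mC + mA * mD,
   mC - 2 * mD + b * mD - b * mB + mA).
Definition normalBD (c : configuration) : point :=
  let (mA, mB, mC, mD, b) := c in
  (- (1 - b) * mC * mD - (b * mB - mA) * mD + b * mB * (mC - mD),
   (1 - b) * mC + (b * mB - mA) - b * (mC - mD)).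

Lemma diag_of_diagonals c u v :
  diagAC (of_diagonals c u v) = u /\ diagBD (of_diagonals c u v) = v.
Proof.
  destruct u as [u1 u2], v as [v1 v2]. unfold of_diagonals. cbv zeta.
  set (mx := _ / (_ - _)). set (my := _ * (_ - _) + _). clearbody mx my.
  split; cbv -[Rplus Rmult Ropp Rinv IZR]; split_pairs; field.
Qed.

Lemma normal_neq_0 c : slopeC c <> slopeD c ->
  0 < dot (normalAC c) (normalAC c) + dot (normalBD c) (normalBD c).
Proof.
  destruct c as [mA mB mC mD b]. unfold dot, normalAC, normalBD; simpl. intros H.
  match goal with |- 0 < ?p * ?p + ?q * ?q + (?r * ?r + ?s * ?s) =>
    assert (N : ~ (p = 0 /\ q = 0 /\ r = 0 /\ s = 0));
    [| destruct (Req_dec p 0), (Req_dec q 0), (Req_dec r 0), (Req_dec s 0); try (exfalso; tauto);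
       assert (0 <= p * p) by apply Rle_0_sqr; assert (0 <= q * q) by apply Rle_0_sqr;
       assert (0 <= r * r) by apply Rle_0_sqr; assert (0 <= s * s) by apply Rle_0_sqr;
       repeat match goal with Hx : ?x <> 0 |- _ => apply Rsqr_pos_lt in Hx; unfold Rsqr in Hx end; lra ]
  end.
  intros (E1 & E2 & E3 & E4).
  (* [F1] pairs [normalAC] with the direction [(1, mC)] of [C], and [F2] pairs [normalBD] with the
     direction [(1, mD)] of [D]; both pairings factor. *)
  assert (F1 : (mC - mD) * (mC - mA) = 0) by (assert (G := Rmult_eq_compat_l mC _ _ E2); lra).
  assert (F2 : (mC - mD) * (b * (mB - mD)) = 0) by (assert (G := Rmult_eq_compat_l mD _ _ E4); lra).
  assert (D : mC - mD <> 0) by lra.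
  destruct (Rmult_integral _ _ F1) as [|F3]; [contradiction|].
  destruct (Rmult_integral _ _ F2) as [|F4]; [contradiction|].
  destruct (Rmult_integral _ _ F4) as [->|F5].
  - lra.
  - assert (mB = mD) by lra. assert (mA = mC) by lra. subst.
    assert (F6 : (mC - mD) * b = 0) by lra.
    destruct (Rmult_integral _ _ F6) as [|F7]; [contradiction|]. subst. lra.
Qed.

(** The lines [C] and [D] fix the center and [B] fixes the scale. What remains is the incidence with
    [A], which becomes orthogonality to the normal after multiplication by [2 * (mC - mD)]. *)
Lemma Pi_space_diagonals c : slopeC c <> slopeD c -> forall P,
  Pi_space c P <-> exists u v, dot (normalAC c) u + dot (normalBD c) v = 0 /\ P = of_diagonals c u v.
Proof.
  intros H P. split.
  - intros (w & HA & HB & HC & HD & E).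
    exists (diagAC P), (diagBD P).
    destruct P as [[[[xA yA] [xB yB]] [xC yC]] [xD yD]].
    destruct c as [mA mB mC mD b].
    unfold lineA, lineB, lineC, lineD, line, vA, vB, vC, vD in *; simpl in *.
    unfold plus in E; simpl in E; unfold prod_plus, plus in E; simpl in E.
    injection E as Ex Ey.
    assert (EM : (mC * (xA - xC) - (yA - yC) - mD * (xB - xD) + (yB - yD)) = (xA + xC) * (mC - mD)).
    { assert (xB = xA + xC - xD) by lra. assert (yB = yA + yC - yD) by lra. subst. lra. }
    split.
    + unfold dot, diagAC, diagBD, minus, plus, opp; simpl.
      unfold prod_plus, prod_opp, plus, opp; simpl.
      assert (xB = xA + xC - xD) by lra.
      assert (w = yB - mB * xB) by lra.
      (* The last factor is [yA - (mA * xA + b * w)], with [yA] expressed by the other vertices. *)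
      transitivity (2 * (mC - mD) * (yB + yD - yC - (mA * xA + b * w))).
      * subst xB w yC yD. replace yA with (yB + mD * xD - mC * xC) by lra. ring.
      * replace (yB + yD - yC - (mA * xA + b * w)) with 0 by lra. ring.
    + unfold of_diagonals, diagAC, diagBD, minus, plus, opp; simpl.
      unfold prod_plus, prod_opp, plus, opp; simpl.
      change (xA + - xC) with (xA - xC). change (xB + - xD) with (xB - xD).
      change (yA + - yC) with (yA - yC). change (yB + - yD) with (yB - yD).
      rewrite EM. replace ((xA + xC) * (mC - mD) / (mC - mD)) with (xA + xC) by (field; lra).
      repeat f_equal; lra.
  - intros ([u1 u2] & [v1 v2] & E & ->).
    destruct c as [mA mB mC mD b]. unfold dot in E; simpl in *.
    unfold of_diagonals; simpl.
    set (mx := (mC * u1 - u2 - mD * v1 + v2) / (mC - mD)).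
    assert (EM : mx * (mC - mD) = mC * u1 - u2 - mD * v1 + v2) by (unfold mx; field; lra).
    clearbody mx.
    set (my := mC * (mx - u1) + u2).
    (* The scale is the intercept that puts the vertex [B] on [B(w)]. *)
    exists ((my + v2) / 2 - mB * ((mx + v1) / 2)).
    unfold inscribed, lineA, lineB, lineC, lineD, line, vA, vB, vC, vD; simpl.
    repeat split; try (unfold my; lra).
    + apply Rmult_eq_reg_l with (2 * (mC - mD)); [|lra].
      assert (v2 = mx * (mC - mD) - mC * u1 + u2 + mD * v1) by lra. subst v2.
      unfold my. apply Rminus_diag_uniq. rewrite <- E. field.
    + unfold plus; simpl; unfold prod_plus, plus; simpl. f_equal; field.
Qed.

(** Take [e] along [p], [f] along [q] and [k = |q| / |p|]. The equation only ties the component of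
    [u] along [e] to that of [v] along [f]; [y] and [z] are the free components along the quarter
    turns of [f] and [e]. *)
Lemma normal_frame (p q : point) : dot q q <= dot p p -> 0 < dot p p ->
  exists k (e f : point), 0 <= k <= 1 /\ dot e e = 1 / 2 /\ dot f f = 1 / 2 /\
   forall u v, dot p u + dot q v = 0 <-> exists x y z,
     u = (- k * x * fst e - z * snd e, - k * x * snd e + z * fst e) /\
     v = (x * fst f - y * snd f, x * snd f + y * fst f).
Proof.
  destruct p as [p1 p2], q as [q1 q2]. unfold dot; simpl. intros Hqp Hp.
  set (N := sqrt (2 * (p1 * p1 + p2 * p2))).
  assert (HN : 0 < N) by (apply sqrt_lt_R0; lra).
  assert (HN2 : N * N = 2 * (p1 * p1 + p2 * p2)) by (apply sqrt_sqrt; lra).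
  assert (He : p1 / N * (p1 / N) + p2 / N * (p2 / N) = 1 / 2).
  { replace (p1 / N * (p1 / N) + p2 / N * (p2 / N)) with ((p1 * p1 + p2 * p2) / (N * N)) by (field; lra).
    rewrite HN2. field. lra. }
  assert (Hf : exists k f1 f2, 0 <= k <= 1 /\ f1 * f1 + f2 * f2 = 1 / 2 /\
            q1 = k * N * f1 /\ q2 = k * N * f2).
  { destruct (Req_dec (q1 * q1 + q2 * q2) 0) as [E|E].
    (* For [q = 0] the direction of [f] is arbitrary, so that of [p] is taken. *)
    - exists 0, (p1 / N), (p2 / N). repeat split; try lra; nra.
    - set (L := sqrt (2 * (q1 * q1 + q2 * q2))).
      assert (HL : 0 < L) by (apply sqrt_lt_R0; nra).
      assert (HL2 : L * L = 2 * (q1 * q1 + q2 * q2)) by (apply sqrt_sqrt; nra).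
      exists (L / N), (q1 / L), (q2 / L). repeat split.
      + apply Rdiv_le_0_compat; lra.
      + apply Rle_div_l; [lra|]. nra.
      + replace (q1 / L * (q1 / L) + q2 / L * (q2 / L)) with ((q1 * q1 + q2 * q2) / (L * L)) by (field; lra).
        rewrite HL2. field. lra.
      + field; lra.
      + field; lra. }
  destruct Hf as (k & f1 & f2 & Hk & Hf & E1 & E2).
  assert (P1 : p1 = N * (p1 / N)) by (field; lra).
  assert (P2 : p2 = N * (p2 / N)) by (field; lra).
  set (e1 := p1 / N) in *. set (e2 := p2 / N) in *. clearbody e1 e2.
  exists k, (e1, e2), (f1, f2). simpl. repeat split; try lra.
  - intros E. destruct u as [u1 u2], v as [v1 v2]; simpl in *.
    assert (EE : u1 * e1 + u2 * e2 = - k * (v1 * f1 + v2 * f2)).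
    { apply Rmult_eq_reg_l with N; [|lra]. rewrite P1, P2, E1, E2 in E. lra. }
    (* The factors 2 invert the squared lengths [1 / 2] of [e] and [f]. *)
    exists (2 * (v1 * f1 + v2 * f2)), (2 * (v2 * f1 - v1 * f2)), (2 * (u2 * e1 - u1 * e2)).
    split; f_equal.
    + transitivity (2 * (u1 * e1 + u2 * e2) * e1 - 2 * (u2 * e1 - u1 * e2) * e2); [|rewrite EE; ring].
      transitivity (2 * u1 * (e1 * e1 + e2 * e2)); [rewrite He; field | ring].
    + transitivity (2 * (u1 * e1 + u2 * e2) * e2 + 2 * (u2 * e1 - u1 * e2) * e1); [|rewrite EE; ring].
      transitivity (2 * u2 * (e1 * e1 + e2 * e2)); [rewrite He; field | ring].
    + transitivity (2 * v1 * (f1 * f1 + f2 * f2)); [rewrite Hf; field | ring].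
    + transitivity (2 * v2 * (f1 * f1 + f2 * f2)); [rewrite Hf; field | ring].
  - intros (x & y & z & -> & ->). simpl. rewrite P1, P2, E1, E2.
    transitivity (N * k * x * ((f1 * f1 + f2 * f2) - (e1 * e1 + e2 * e2))); [ring|].
    rewrite He, Hf. ring.
Qed.

(** The alternative records which half of the normal is longer: [normal_frame] wants the longer one
    first, and that half is nonzero by [normal_neq_0]. *)
Lemma Pi_frame c : slopeC c <> slopeD c ->
  exists (k : R) (P1 P2 P3 : quad), 0 <= k <= 1 /\
    (forall P, Pi_space c P <-> exists x y z, P = comb P1 P2 P3 x y z) /\
    ((forall x y z, let P := comb P1 P2 P3 x y z in
       dot (diagBD P) (diagBD P) = (x ^ 2 + y ^ 2) / 2 /\
       dot (diagAC P) (diagAC P) = (k ^ 2 * x ^ 2 + z ^ 2) / 2) \/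
     (forall x y z, let P := comb P1 P2 P3 x y z in
       dot (diagAC P) (diagAC P) = (x ^ 2 + y ^ 2) / 2 /\
       dot (diagBD P) (diagBD P) = (k ^ 2 * x ^ 2 + z ^ 2) / 2)).
Proof.
  intros H. assert (Hn := normal_neq_0 c H). assert (HP := Pi_space_diagonals c H).
  set (p := normalAC c) in *. set (q := normalBD c) in *. clearbody p q.
  destruct (Rle_or_lt (dot q q) (dot p p)) as [Hqp|Hqp].
  - destruct (normal_frame p q Hqp) as (k & e & f & Hk & He & Hf & HF); [lra|].
    set (D := fun x y z => of_diagonals c
      (- k * x * fst e - z * snd e, - k * x * snd e + z * fst e)
      (x * fst f - y * snd f, x * snd f + y * fst f)).
    exists k, (D 1 0 0), (D 0 1 0), (D 0 0 1).
    (* [of_diagonals] is linear, so the images of the three unit coordinate vectors span. *)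
    assert (HD : forall x y z, comb (D 1 0 0) (D 0 1 0) (D 0 0 1) x y z = D x y z).
    { intros x y z. destruct e as [e1 e2], f as [f1 f2], c as [mA mB mC mD b]. unfold D; clear.
      cbv -[Rplus Rmult Ropp Rinv IZR]. split_pairs; ring. }
    split; [exact Hk|]. split; [|left].
    + intros P. rewrite HP. split.
      * intros (u & v & (x & y & z & -> & ->)%HF & ->). exists x, y, z. now rewrite HD.
      * intros (x & y & z & ->). rewrite HD. do 2 eexists. split; [|reflexivity].
        apply HF. now exists x, y, z.
    + intros x y z. cbv zeta. rewrite HD. unfold D.
      rewrite (proj1 (diag_of_diagonals _ _ _)), (proj2 (diag_of_diagonals _ _ _)).
      unfold dot in *; simpl fst; simpl snd; split.
      * transitivity ((x ^ 2 + y ^ 2) * (fst f * fst f + snd f * snd f)); [ring|]. rewrite Hf. field.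
      * transitivity ((k ^ 2 * x ^ 2 + z ^ 2) * (fst e * fst e + snd e * snd e)); [ring|]. rewrite He. field.
  - destruct (normal_frame q p) as (k & e & f & Hk & He & Hf & HF); [lra|lra|].
    set (D := fun x y z => of_diagonals c
      (x * fst f - y * snd f, x * snd f + y * fst f)
      (- k * x * fst e - z * snd e, - k * x * snd e + z * fst e)).
    exists k, (D 1 0 0), (D 0 1 0), (D 0 0 1).
    assert (HD : forall x y z, comb (D 1 0 0) (D 0 1 0) (D 0 0 1) x y z = D x y z).
    { intros x y z. destruct e as [e1 e2], f as [f1 f2], c as [mA mB mC mD b]. unfold D; clear.
      cbv -[Rplus Rmult Ropp Rinv IZR]. split_pairs; ring. }
    split; [exact Hk|]. split; [|right].
    + intros P. rewrite HP. split.
      * intros (u & v & E & ->). rewrite Rplus_comm in E.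
        apply HF in E as (x & y & z & -> & ->). exists x, y, z. now rewrite HD.
      * intros (x & y & z & ->). rewrite HD. do 2 eexists. split; [|reflexivity].
        rewrite Rplus_comm. apply HF. now exists x, y, z.
    + intros x y z. cbv zeta. rewrite HD. unfold D.
      rewrite (proj1 (diag_of_diagonals _ _ _)), (proj2 (diag_of_diagonals _ _ _)).
      unfold dot in *; simpl fst; simpl snd; split.
      * transitivity ((x ^ 2 + y ^ 2) * (fst f * fst f + snd f * snd f)); [ring|]. rewrite Hf. field.
      * transitivity ((k ^ 2 * x ^ 2 + z ^ 2) * (fst e * fst e + snd e * snd e)); [ring|]. rewrite He. field.
Qed.

(** * Vector-valued power series and regularity *)

Lemma is_pseries_scal_vector {V : NormedModule R_AbsRing} (a : nat -> R) (v : V) (x l : R) :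
  is_pseries a x l -> is_pseries (fun n => scal (a n) v) x (scal l v).
Proof.
  unfold is_pseries, is_series. intros H.
  apply filterlim_ext with (fun n => scal (sum_n (fun k => scal (pow_n x k) (a k)) n) v).
  { intros n. induction n as [|n IH].
    - rewrite !sum_O. exact (eq_sym (scal_assoc _ _ _)).
    - rewrite !sum_Sn, <- IH, scal_assoc. exact (scal_distr_r _ _ _). }
  (* The vector partial sums are images of the real ones under the continuous map [scal _ v]. *)
  apply (filterlim_comp _ _ _ (sum_n (fun k => scal (pow_n x k) (a k)))
           (fun y => scal y v) _ (locally l) _ H).
  exact (filterlim_scal_l l v).
Qed.

Lemma is_pseries_comb {V : NormedModule R_AbsRing} (v1 v2 v3 : V)
    (a1 a2 a3 : nat -> R) (x l1 l2 l3 : R) :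
  is_pseries a1 x l1 -> is_pseries a2 x l2 -> is_pseries a3 x l3 ->
  is_pseries (fun n => plus (plus (scal (a1 n) v1) (scal (a2 n) v2)) (scal (a3 n) v3)) x
    (plus (plus (scal l1 v1) (scal l2 v2)) (scal l3 v3)).
Proof.
  intros H1 H2 H3.
  apply (is_pseries_plus (fun n => plus (scal _ v1) (scal _ v2)) (fun n => scal (a3 n) v3)).
  - apply (is_pseries_plus (fun n => scal (a1 n) v1) (fun n => scal (a2 n) v2));
      now apply is_pseries_scal_vector.
  - now apply is_pseries_scal_vector.
Qed.

(** The derivative has first coordinates [- sin t] and [cos t], which never vanish together,
    whatever the third coordinate does. *)
Lemma regular_analytic_comb P1 P2 P3 (F : R -> quad) z t a :
  (forall s, F s = comb P1 P2 P3 (cos s) (sin s) (z s)) ->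
  (forall x y w, comb P1 P2 P3 x y w = zero -> x = 0 /\ y = 0) ->
  expands z t a -> regular_analytic_at F t.
Proof.
  intros HF Hind Hz.
  destruct (expands_cos t) as (r1 & Hr1 & E1), (expands_sin t) as (r2 & Hr2 & E2), Hz as (r3 & Hr3 & E3).
  exists (fun n => comb P1 P2 P3 (trig_coef (cos t) (- sin t) n) (trig_coef (sin t) (cos t) n) (a n)).
  exists (Rmin r1 (Rmin r2 r3)). split; [repeat apply Rmin_glb_lt; assumption|]. split.
  - intros s Hs. assert (H1 := Rmin_l r1 (Rmin r2 r3)). assert (H2 := Rmin_r r1 (Rmin r2 r3)).
    assert (H3 := Rmin_l r2 r3). assert (H4 := Rmin_r r2 r3).
    rewrite HF.
    exact (is_pseries_comb P1 P2 P3 _ _ _ _ _ _ _ (E1 s ltac:(lra)) (E2 s ltac:(lra)) (E3 s ltac:(lra))).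
  - intros E. apply Hind in E. rewrite !trig_coef_1 in E.
    assert (H := sin2_cos2 t). unfold Rsqr in H. nra.
Qed.

(** * Angles and periods *)

Lemma cos_sin_eq s t : cos s = cos t -> sin s = sin t -> exists k : Z, s = t + IZR k * (2 * PI).
Proof.
  intros Hc Hs. destruct (sin_eq_0_0 ((s - t) / 2)) as [k Hk].
  - assert (H : cos (2 * ((s - t) / 2)) = 1).
    { replace (2 * ((s - t) / 2)) with (s - t) by field.
      rewrite cos_minus, Hc, Hs. rewrite <- (sin2_cos2 t). unfold Rsqr. ring. }
    rewrite cos_2a_sin in H. nra.
  - exists k. lra.
Qed.

Lemma cos_sin_period t (k : Z) :
  cos (t + IZR k * (2 * PI)) = cos t /\ sin (t + IZR k * (2 * PI)) = sin t.
Proof.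
  destruct (Z.le_gt_cases 0 k) as [Hk|Hk].
  - replace (IZR k * (2 * PI)) with (2 * INR (Z.to_nat k) * PI).
    + now rewrite cos_period, sin_period.
    + rewrite INR_IZR_INZ, Z2Nat.id by lia. ring.
  - set (s := t + IZR k * (2 * PI)).
    replace t with (s + 2 * INR (Z.to_nat (- k)) * PI).
    + now rewrite cos_period, sin_period.
    + rewrite INR_IZR_INZ, Z2Nat.id by lia. rewrite opp_IZR. unfold s. ring.
Qed.

Lemma exists_angle x y : x ^ 2 + y ^ 2 = 1 -> exists t, cos t = x /\ sin t = y.
Proof.
  intros H. assert (Hx : -1 <= x <= 1) by nra.
  assert (S : sin (acos x) ^ 2 = y ^ 2).
  { assert (E := sin2_cos2 (acos x)). rewrite cos_acos in E by exact Hx. unfold Rsqr in E. nra. }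
  destruct (Req_dec (sin (acos x)) y) as [E|E].
  - exists (acos x). split; [now apply cos_acos | exact E].
  - exists (- acos x). rewrite cos_neg, sin_neg. split; [now apply cos_acos|]. nra.
Qed.

(** * The curve of unit rectangles *)

(** The nonnegative [z] with [k ^ 2 * x ^ 2 + z ^ 2 = 1] for [x = cos t], so that both diagonals
    have squared length [1 / 2]. *)
Definition height (k t : R) : R := sqrt (1 + - k ^ 2 * (cos t * cos t)).

Definition oval (P1 P2 P3 : quad) (k t : R) : quad :=
  comb P1 P2 P3 (cos t) (sin t) (height k t).

Lemma height_radicand_ge0 k t : 0 <= k <= 1 -> 0 <= 1 + - k ^ 2 * (cos t * cos t).
Proof.
  intros Hk. assert (H := sin2_cos2 t). unfold Rsqr in H.
  assert (0 <= k ^ 2 <= 1) by nra. nra.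
Qed.

Lemma height_1 t : height 1 t = Rabs (sin t).
Proof.
  unfold height. rewrite <- sqrt_Rsqr_abs. f_equal.
  assert (H := sin2_cos2 t). unfold Rsqr in *. lra.
Qed.

Lemma expands_height k t :
  0 < 1 + - k ^ 2 * (cos t * cos t) -> exists a, expands (height k) t a.
Proof.
  intros H. apply (expands_sqrt (fun s => 1 + - k ^ 2 * (cos s * cos s)) _ _
    (expands_affine 1 (- k ^ 2) _ _ _ (expands_mult _ _ _ _ _ (expands_cos t) (expands_cos t)))).
  exact H.
Qed.

Lemma oval_regular P1 P2 P3 k t :
  (forall x y w, comb P1 P2 P3 x y w = zero -> x = 0 /\ y = 0) ->
  0 < 1 + - k ^ 2 * (cos t * cos t) -> regular_analytic_at (oval P1 P2 P3 k) t.
Proof.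
  intros Hind H. destruct (expands_height k t H) as [a Ha].
  now apply (regular_analytic_comb P1 P2 P3 _ (height k) t a).
Qed.

(** Here the oval is [(cos, sin, |sin|)], and on either side of a zero [t] of the sine,
    [|sin s| = +- cos t sin s]. *)
Lemma oval_corner P1 P2 P3 t :
  (forall x y w, comb P1 P2 P3 x y w = zero -> x = 0 /\ y = 0) ->
  sin t = 0 -> corner_at (oval P1 P2 P3 1) t.
Proof.
  intros Hind Hs.
  assert (Hc : cos t * cos t = 1). { assert (H := sin2_cos2 t). unfold Rsqr in H. nra. }
  assert (Hsin : forall s, cos t * sin s = sin (s - t)).
  { intros s. rewrite sin_minus, Hs. ring. }
  assert (Habs : forall s, height 1 s = Rabs (sin (s - t))).
  { intros s. rewrite height_1, <- Hsin, Rabs_mult.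
    replace (Rabs (cos t)) with 1; [ring|]. symmetry. rewrite <- sqrt_Rsqr_abs.
    unfold Rsqr. rewrite Hc. apply sqrt_1. }
  assert (HPI := PI_RGT_0).
  assert (Han : forall q, regular_analytic_at
            (fun s => comb P1 P2 P3 (cos s) (sin s) (0 + q * sin s)) t).
  { intros q. eapply (regular_analytic_comb P1 P2 P3 _ (fun s => 0 + q * sin s) t);
      [reflexivity | exact Hind | exact (expands_affine 0 q _ _ _ (expands_sin t))]. }
  exists (fun s => comb P1 P2 P3 (cos s) (sin s) (0 + - cos t * sin s)),
         (fun s => comb P1 P2 P3 (cos s) (sin s) (0 + cos t * sin s)), PI.
  repeat split; auto.
  - intros s H. unfold oval. f_equal. rewrite Habs.
    replace (0 + - cos t * sin s) with (- sin (s - t)) by (rewrite <- Hsin; ring).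
    apply Rabs_left1. replace (s - t) with (- (t - s)) by ring. rewrite sin_neg.
    assert (0 <= sin (t - s)) by (apply sin_ge_0; lra). lra.
  - intros s H. unfold oval. f_equal. rewrite Habs, Rplus_0_l, Hsin.
    apply Rabs_pos_eq, sin_ge_0; lra.
Qed.

Theorem theorem4p2 (c : configuration)
  (not_concurrent :
     ~ exists p, lineA c 1 p /\ lineB c 1 p /\ lineC c 1 p /\ lineD c 1 p)
  (CD_origin : forall p, lineC c 1 p /\ lineD c 1 p <-> p = (0, 0)) :
  exists S : quad -> Prop,
    simple_closed_analytic_curve (double_points S) S /\
    (forall P, S P -> Pi_space c P) /\
    conformal_solution c S /\
    (forall P, (S P \/ neg_set S P) <-> unit_rectangle c P).
Proof.
  assert (HCD : slopeC c <> slopeD c).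
  { intros E. destruct (CD_origin (1, slopeC c)) as [H _].
    assert (H0 : (1, slopeC c) = (0, 0)).
    { apply H. unfold lineC, lineD, line; simpl. rewrite <- E. lra. }
    injection H0. lra. }
  destruct (Pi_frame c HCD) as (k & P1 & P2 & P3 & Hk & HPi & Hdot).
  assert (Hinner : forall x y z, inner (comb P1 P2 P3 x y z) (comb P1 P2 P3 x y z)
                     = (x ^ 2 + y ^ 2) / 2 + (k ^ 2 * x ^ 2 + z ^ 2) / 2).
  { intros x y z. unfold inner. destruct Hdot as [Hd|Hd]; destruct (Hd x y z) as [-> ->]; ring. }
  assert (Hrect : forall x y z, rectangle c (comb P1 P2 P3 x y z) <->
            x ^ 2 + y ^ 2 = k ^ 2 * x ^ 2 + z ^ 2).
  { intros x y z.
    assert (G1 : 0 <= (x ^ 2 + y ^ 2) / 2) by nra.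
    assert (G2 : 0 <= (k ^ 2 * x ^ 2 + z ^ 2) / 2).
    { assert (0 <= (k * x) ^ 2) by apply pow2_ge_0. assert (0 <= z ^ 2) by apply pow2_ge_0. nra. }
    assert (HP : Pi_space c (comb P1 P2 P3 x y z)) by (apply HPi; now exists x, y, z).
    unfold rectangle, length.
    destruct Hdot as [Hd|Hd]; destruct (Hd x y z) as [-> ->]; split.
    - intros [_ E%sqrt_inj]; lra.
    - intros E. split; [exact HP|]. f_equal. lra.
    - intros [_ E%sqrt_inj]; lra.
    - intros E. split; [exact HP|]. f_equal. lra. }
  (* The inner product is positive definite in these coordinates, so [P1], [P2], [P3] are linearly
     independent. *)
  assert (Hzero : forall x y z, comb P1 P2 P3 x y z = zero -> x = 0 /\ y = 0 /\ z = 0).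
  { intros x y z E. assert (H := Hinner x y z).
    assert (H0 := Hinner 0 0 0). rewrite comb_0, <- E, H in H0.
    assert (0 <= (k * x) ^ 2) by apply pow2_ge_0.
    assert (0 <= x ^ 2) by apply pow2_ge_0. assert (0 <= y ^ 2) by apply pow2_ge_0.
    assert (0 <= z ^ 2) by apply pow2_ge_0.
    repeat split; apply Rsqr_0_uniq; unfold Rsqr; lra. }
  assert (Hind : forall x y w, comb P1 P2 P3 x y w = zero -> x = 0 /\ y = 0).
  { intros x y w E. apply Hzero in E. tauto. }
  assert (Hinj : forall x y z x' y' z', comb P1 P2 P3 x y z = comb P1 P2 P3 x' y' z' ->
            x = x' /\ y = y' /\ z = z').
  { intros x y z x' y' z' E. destruct (Hzero (x - x') (y - y') (z - z')) as (E1 & E2 & E3); [|lra].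
    rewrite <- comb_minus, E, comb_minus, !Rminus_diag. apply comb_0. }
  assert (Hreg := fun t => oval_regular P1 P2 P3 k t Hind).
  assert (Hcorner : forall t, k = 1 -> sin t = 0 -> corner_at (oval P1 P2 P3 k) t).
  { intros t ->. now apply oval_corner. }
  set (f := oval P1 P2 P3 k) in *.
  assert (Hf : forall t, f t = comb P1 P2 P3 (cos t) (sin t) (height k t)) by reflexivity.
  clearbody f.
  assert (Hh2 : forall t, height k t ^ 2 = 1 - k ^ 2 * cos t ^ 2).
  { intros t. unfold height. rewrite pow2_sqrt by exact (height_radicand_ge0 k t Hk). ring. }
  assert (Hh0 : forall t, 0 <= height k t) by (intros; apply sqrt_pos).
  assert (Hcs : forall t, cos t ^ 2 + sin t ^ 2 = 1).
  { intros t. rewrite <- (sin2_cos2 t). unfold Rsqr. ring. }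
  assert (Hfrect : forall t, rectangle c (f t)).
  { intros t. rewrite Hf. apply Hrect. rewrite Hh2, Hcs. ring. }
  assert (Hfnorm : forall t, inner (f t) (f t) = 1).
  { intros t. rewrite Hf, Hinner, Hh2, Hcs. field. }
  assert (Hcover : forall x y z, x ^ 2 + y ^ 2 = 1 -> k ^ 2 * x ^ 2 + z ^ 2 = 1 -> 0 <= z ->
            exists t, f t = comb P1 P2 P3 x y z).
  { intros x y z E1 E2 Hz. destruct (exists_angle x y E1) as (t & <- & <-). exists t.
    rewrite Hf. f_equal. apply Rsqr_inj; auto.
    rewrite !Rsqr_pow2, Hh2. lra. }
  (* Opposite points have opposite heights, and all heights are [>= 0]. *)
  assert (Hopp : forall s t, f s = opp (f t) -> sin t = 0 /\ height k t = 0).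
  { intros s t E. rewrite !Hf, comb_opp in E.
    apply Hinj in E as (E1 & E2 & E3). assert (H1 := Hh0 s). assert (H2 := Hh0 t).
    assert (Ht : height k t = 0) by lra. split; [|exact Ht].
    assert (H3 := Hh2 t). rewrite Ht in H3. assert (H4 := Hcs t).
    assert (0 <= sin t ^ 2) by apply pow2_ge_0. assert (0 <= k ^ 2 <= 1) by nra.
    assert (sin t ^ 2 = 0) by nra. apply Rsqr_0_uniq; unfold Rsqr; lra. }
  exists (fun P => exists t, f t = P).
  split; [|split; [|split]].
  - exists f, (2 * PI). split; [assert (H := PI_RGT_0); lra|]. split; [|split].
    + intros s t. split.
      * intros E. rewrite !Hf in E. apply Hinj in E as (E1 & E2 & _).
        now apply cos_sin_eq.
      * intros (m & ->). rewrite !Hf. unfold height.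
        destruct (cos_sin_period t m) as [-> ->]. reflexivity.
    + reflexivity.
    + intros t. destruct (Rle_lt_or_eq_dec _ _ (height_radicand_ge0 k t Hk)) as [H|H].
      * left. now apply Hreg.
      * right.
        (* A zero radicand means [k ^ 2 * cos t ^ 2 = 1] with both factors at most 1. *)
        assert (k = 1 /\ sin t = 0) as [Hk1 Hst].
        { assert (H4 := Hcs t). assert (0 <= sin t ^ 2) by apply pow2_ge_0.
          assert (0 <= k ^ 2 <= 1) by nra. assert (sin t ^ 2 = 0) by nra.
          split; [nra|]. apply Rsqr_0_uniq; unfold Rsqr; lra. }
        split.
        (* At height 0 a half turn negates all three coordinates, so [f t] is a double point. *)
        -- split; [now exists t|]. exists (f (t + PI)). split; [now exists (t + PI)|].
           rewrite !Hf. unfold height. rewrite comb_opp, neg_cos, neg_sin, !Ropp_involutive.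
           f_equal. rewrite Rmult_opp_opp, <- H, sqrt_0. ring.
        -- now apply Hcorner.
  - intros P [t <-]. apply Hfrect.
  (* Divide by [n] or [- n], whichever makes the third coordinate nonnegative; the quotient then
     lies on the curve. *)
  - assert (Hscale : forall P, rectangle c P -> P <> zero ->
              exists a t, a <> 0 /\ P = scal a (f t)).
    { intros P HR HP. assert (HR' := HR). destruct HR' as [HP' _].
      apply HPi in HP' as (x & y & z & ->). apply Hrect in HR.
      set (n := sqrt (x ^ 2 + y ^ 2)).
      assert (Hn : 0 < x ^ 2 + y ^ 2).
      { apply Rnot_le_lt. intros H. apply HP.
        assert (0 <= x ^ 2) by apply pow2_ge_0. assert (0 <= y ^ 2) by apply pow2_ge_0.
        assert (x = 0) by (apply Rsqr_0_uniq; unfold Rsqr; lra).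
        assert (y = 0) by (apply Rsqr_0_uniq; unfold Rsqr; lra). subst x y.
        assert (z = 0) by (apply Rsqr_0_uniq; unfold Rsqr; lra). subst z. apply comb_0. }
      assert (Hn0 : 0 < n) by now apply sqrt_lt_R0.
      assert (Hn2 : n ^ 2 = x ^ 2 + y ^ 2) by (apply pow2_sqrt; lra).
      assert (HA : forall a, a ^ 2 = n ^ 2 -> 0 <= z / a -> exists t, comb P1 P2 P3 x y z = scal a (f t)).
      { intros a Ha Hza. assert (Ha0 : a <> 0) by nra.
        destruct (Hcover (x / a) (y / a) (z / a)) as [t Ht]; auto.
        - replace ((x / a) ^ 2 + (y / a) ^ 2) with ((x ^ 2 + y ^ 2) / a ^ 2) by (field; lra).
          rewrite Ha, Hn2. field. lra.
        - replace (k ^ 2 * (x / a) ^ 2 + (z / a) ^ 2) with ((k ^ 2 * x ^ 2 + z ^ 2) / a ^ 2) by (field; lra).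
          rewrite Ha, Hn2, HR. field. lra.
        - exists t. rewrite Ht. rewrite comb_scal. f_equal; field; lra. }
      destruct (Rle_or_lt 0 z) as [Hz|Hz].
      - destruct (HA n) as [t Ht]; [reflexivity | apply Rdiv_le_0_compat; lra |].
        exists n, t. split; [lra|auto].
      - destruct (HA (- n)) as [t Ht]; [ring | |].
        { replace (z / - n) with (- z / n) by (field; lra). apply Rdiv_le_0_compat; lra. }
        exists (- n), t. split; [lra|auto]. }
    (* The first two coordinates of curve points form unit vectors, so [a ^ 2 = b ^ 2]. *)
    assert (Hpar : forall a b s t, a <> 0 -> scal a (f s) = scal b (f t) ->
              f s = f t \/ f t = opp (f s)).
    { intros a b s t Ha E. rewrite !Hf in E |- *.
      rewrite !comb_scal in E. apply Hinj in E as (E1 & E2 & E3). rewrite comb_opp.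
      assert (Hab : (a - b) * (a + b) = 0).
      { assert (Hs := Hcs s). assert (Ht := Hcs t).
        transitivity (a ^ 2 * (cos s ^ 2 + sin s ^ 2) - b ^ 2 * (cos t ^ 2 + sin t ^ 2)).
        - rewrite Hs, Ht. ring.
        - transitivity ((a * cos s) ^ 2 + (a * sin s) ^ 2 - (b * cos t) ^ 2 - (b * sin t) ^ 2); [ring|].
          rewrite E1, E2. ring. }
      apply Rmult_integral in Hab as [Hab|Hab]; [left|right]; f_equal;
        apply Rmult_eq_reg_l with a; auto; [replace b with a in * by lra..|
        replace b with (- a) in * by lra | replace b with (- a) in * by lra |
        replace b with (- a) in * by lra]; lra. }
    (* A second representative would be the opposite of the first, which by [Hopp] forces
       [sin t = 0] and height 0. So every exceptional rectangle is a multiple of [P1], and any two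
       are multiples of each other. *)
    assert (Hmulti : forall P, target_rectangle c P ->
        ~ (exists! P', (exists t, f t = P') /\ scaled_from P P') ->
        exists a, a <> 0 /\ P = scal a P1).
    { intros P (HR & HP & _) HN. destruct (Hscale P HR HP) as (a & t & Ha & ->).
      destruct (classic (sin t = 0 /\ height k t = 0)) as [[Hst Hht]|Hne].
      - exists (a * cos t). split.
        + apply Rmult_integral_contrapositive. split; [exact Ha|]. intros E.
          assert (H := Hcs t). rewrite E, Hst in H. lra.
        + rewrite Hf, comb_scal, Hst, Hht, !Rmult_0_r. apply comb_fst.
      - destruct HN. exists (f t). split; [split; [now exists t | now exists a]|].
        intros P' [[s <-] [b E]]. destruct (Hpar a b t s Ha E) as [H|H]; [exact H|].
        now apply Hopp in H. }
    split; [|split].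
    + intros P [t <-]. apply Hfrect.
    + intros P (HR & HP & _). destruct (Hscale P HR HP) as (a & t & _ & ->).
      exists (f t). split; [now exists t | now exists a].
    + intros P Q TP TQ NP NQ.
      destruct (Hmulti P TP NP) as (a & Ha & ->), (Hmulti Q TQ NQ) as (b & Hb & ->).
      exists (a / b). rewrite scal_assoc. f_equal. change (a = a / b * b). field. exact Hb.
  - intros P. unfold unit_rectangle, Pi_norm. split.
    + intros [[t <-]|(Q & [t <-] & ->)].
      * split; [apply Hfrect|]. now rewrite Hfnorm, sqrt_1.
      * assert (H1 := Hfrect t). assert (H2 := Hfnorm t). rewrite Hf in *.
        rewrite comb_opp. rewrite Hrect in H1 |- *. rewrite Hinner in H2 |- *.
        split; [rewrite <- !Rsqr_pow2, <- !Rsqr_neg, !Rsqr_pow2; exact H1|].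
        rewrite <- sqrt_1. f_equal. rewrite <- H2, <- !Rsqr_pow2, <- !Rsqr_neg. reflexivity.
    + intros [HR HN]. assert (HR' := HR). destruct HR' as [HP' _].
      apply HPi in HP' as (x & y & z & ->). apply Hrect in HR.
      assert (HN2 : inner (comb P1 P2 P3 x y z) (comb P1 P2 P3 x y z) = 1).
      (* [sqrt] is 0 on negative numbers, so norm 1 excludes a negative inner product. *)
      { apply sqrt_inj; [|lra|now rewrite sqrt_1].
        apply Rnot_lt_le. intros Hlt. rewrite sqrt_neg_0 in HN; lra. }
      rewrite Hinner in HN2.
      (* The sign of [z] decides between the curve and its negative. *)
      destruct (Rle_or_lt 0 z) as [Hz|Hz].
      * left. apply Hcover; lra.
      * right. exists (comb P1 P2 P3 (- x) (- y) (- z)). split.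
        -- apply Hcover; [| |lra]; rewrite <- !Rsqr_pow2, <- !Rsqr_neg, !Rsqr_pow2; lra.
        -- now rewrite comb_opp, !Ropp_involutive.
Qed.
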